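(* There is an absolute constant $C>0$ such that the following holds. Let $A\in\mathbb{Z}^{m\times d}$ and $b\in\mathbb{Z}^m$ be such that $P=\{x\in\mathbb{R}^d: Ax\le b\}$ is a bounded polytope containing the origin in its interior, and suppose that every $d\times d$ minor of the $m\times(d+1)$ matrix $[A|b]$ has determinant bounded in absolute value by $\Delta$. Then the vertex diameter of $P$ is at most $$C\, d^2\,\Delta\,\|A\|_\infty\cdot\log\left(m\,\|A\|_\infty\,\|b\|_\infty\,\Delta\right).$$
   Context: $\|\cdot\|_\infty$ denotes the maximum magnitude of an entry of a matrix or vector. $[A|b]$ is the matrix obtained by appending $b$ to $A$ as an additional column. The vertex diameter of a bounded polytope is the diameter of the graph formed by its vertices and its edges ($1$-dimensional faces). *)

(* Defs.v *)
From HB Require Import structures.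
From mathcomp Require Import all_boot all_order all_algebra.
From mathcomp Require Import all_classical all_reals all_analysis.

Set Implicit Arguments.
Unset Strict Implicit.
Unset Printing Implicit Defensive.

Import Order.TTheory GRing.Theory Num.Theory.
Import numFieldNormedType.Exports.

Local Open Scope classical_set_scope.
Local Open Scope ring_scope.

Section Graph.
Context {R : realType} {T : Type}.
Implicit Types (V : set T) (adj : T -> T -> Prop) (u v : T).

Definition walk adj (n : nat) u v : Prop :=
  exists p : nat -> T,
    [/\ p 0%N = u, p n = v & forall i, (i < n)%N -> adj (p i) (p i.+1)].

(* Distances live in \bar R: vertices in different components are at
   distance +oo. *)
Definition graph_dist adj u v : \bar R :=
  ereal_inf [set (n%:R)%:E | n in [set n | walk adj n u v]].

Definition graph_diameter V adj : \bar R :=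
  ereal_sup [set graph_dist adj u v | u in V & v in V].

End Graph.

Section Polyhedra.
Context {R : realType} {d : nat}.
Implicit Types (P F S : set 'cV[R]_d) (u v : 'cV[R]_d).

(* x0 and the translates x0 + col j B are k + 1 affinely independent points of
   S whose affine hull contains S. *)
Definition has_affine_dim S (k : nat) : Prop :=
  exists (x0 : 'cV[R]_d) (B : 'M[R]_(d, k)),
    [/\ S x0, forall j, S (x0 + col j B), \rank B = k &
        forall x, S x -> exists y : 'cV[R]_k, x = x0 + B *m y].

Definition is_face P F : Prop :=
  exists (c : 'rV[R]_d) (delta : R),
    (forall x, P x -> (c *m x) 0 0 <= delta) /\
    F = P `&` [set x | (c *m x) 0 0 = delta].

Definition vertices P : set 'cV[R]_d := [set v | is_face P [set v]].

Definition vertex_adj P u v : Prop :=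
  [/\ vertices P u, vertices P v, u <> v &
      exists F, [/\ is_face P F, has_affine_dim F 1, F u & F v]].

Definition vertex_diameter P : \bar R :=
  graph_diameter (vertices P) (vertex_adj P).

End Polyhedra.

Section IntegerData.
Context (R : realType).

Definition realmx m n (M : 'M[int]_(m, n)) : 'M[R]_(m, n) := map_mx intr M.

Definition polyhedron m d (A : 'M[int]_(m, d)) (b : 'cV[int]_m) :
    set 'cV[R]_d :=
  [set x | forall i, (realmx A *m x) i 0 <= realmx b i 0].

(* The norm on matrices over R is the largest absolute value of an entry. *)
Definition maxnorm m n (M : 'M[int]_(m, n)) : R := `|realmx M|.

End IntegerData.

Arguments polyhedron R {m d} A b.
Arguments maxnorm R {m n} M.

(* Rows and columns of the submatrix are kept in their original order. *)
Definition minors_bounded (R : realType) k m n (M : 'M[int]_(m, n))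
    (Delta : R) : Prop :=
  forall (f : 'I_k -> 'I_m) (g : 'I_k -> 'I_n),
    {homo f : i j / (i < j)%N} -> {homo g : i j / (i < j)%N} ->
    `|(\det (mxsub f g M))%:~R| <= Delta.

(* Main.v *)
Require Import Defs.
From HB Require Import structures.
From mathcomp Require Import all_boot all_order all_algebra perm.
From mathcomp Require Import all_classical all_reals all_analysis.
From mathcomp Require Import ring lra zify.
Import Order.TTheory GRing.Theory Num.Theory.
Import numFieldNormedType.Exports.
Local Open Scope classical_set_scope.
Local Open Scope ring_scope.

Set Implicit Arguments.
Unset Strict Implicit.
Unset Printing Implicit Defensive.

(** The normal cones C_v of the vertices v of P tile the space of objectives:
    x lies in C_v exactly when v maximises x over P, and two cones sharing a wall
    belong to adjacent vertices.  A segment of objectives therefore links the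
    optimal vertices at its two ends by a walk inside the set of vertices that
    are optimal somewhere on it (optimal_segment_cut, connected_walk), and it is
    enough to find a path of objectives meeting few cones.

    To join u and v, let c_u be a sum of d independent constraint rows tight at
    u, so that c_u is deep inside C_u, and likewise c_v.  The path runs from
    x + S c_u to x and then to x + S c_v, where S is so large that u and v are
    optimal at its ends.  The point x ranges over the finite set B(n) of sums of
    at most n rows of A, and a good x is found by averaging.

    Only two facts about the cones are used.  An edge direction z at w can be
    scaled so that all its products with rows of A are, up to sign, d x d minors
    of A: they are integers of absolute value at most Delta
    (extreme_ray_integral), and c_w has product at most -1 with z
    (extreme_ray_push).  Hence, if w is optimal at some
    objective of a short piece of the path, then at the first objective of the
    piece each edge inequality at w fails by less than t, and adding t c_w makes
    w the unique optimum (pushed_unique).  Since x + t c_w lies in B(n + t d) and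
    determines w, it determines x too: the number of pairs (x, w) such that w is
    met on this piece is at most |B(n + t d)| (count_hits).

    Sums of at most n rows have polynomially bounded entries, so |B(n)| is at most
    (K n + 1)^d, and as (1 + 1/d)^d < 4 there is a scale n = t d^2 with
    |B(n + t d)| <= 4 |B(n)| (growth_scale).  At this scale a piece may be
    [0, t / (2 d Delta)], or may multiply the coefficient s of c by
    1 + 1/(d^2 Delta); on average over x, each piece meets at most 4 cones.  The
    coefficient has to reach n Delta, so O(d^2 Delta log(d Delta)) pieces are
    enough.  A bounded polytope has at least d constraints, and the maximum norms
    of A and b are at least 1, whence the bound as stated. *)

(** * Step lengths *)

Section Scalars.
Context {R : realFieldType}.

(** For moving a point both ways along a line without using up the slacks f of
    its constraints, which change at the rates g. *)
Lemma small_step {I : finType} (f g : I -> R) :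
  (forall i, 0 < f i) -> exists2 e, 0 < e & forall i, e * `|g i| <= f i.
Proof.
move=> fpos; pose S := \sum_i `|g i| / f i.
have S0 : 0 <= S by apply: sumr_ge0 => i _; rewrite divr_ge0 // ltW.
exists (1 + S)^-1; first by rewrite invr_gt0; lra.
move=> i; rewrite mulrC ler_pdivrMr; last by lra.
have : `|g i| / f i <= S.
  rewrite /S (bigD1 i) //= lerDl; apply: sumr_ge0 => j _.
  by rewrite divr_ge0 // ltW.
rewrite ler_pdivrMr // => h; apply: (le_trans h).
by rewrite mulrC ler_wpM2l ?(ltW (fpos i))//; lra.
Qed.

(** The ratio test of the simplex method: t is the largest step along the rates
    g that respects the slacks f, and k is a constraint that blocks it. *)
Lemma ratio_test {I : finType} (T : pred I) (f g : I -> R) :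
  (forall i, T i -> 0 <= f i) -> (forall i, T i -> 0 < g i -> 0 < f i) ->
  (exists2 i, T i & 0 < g i) ->
  exists t, [/\ 0 < t, forall i, T i -> t * g i <= f i &
                exists k, [/\ T k, 0 < g k & t * g k = f k]].
Proof.
move=> f0 fpos [i0 Ti0 gi0].
pose Q i := T i && (0 < g i).
have Qi0 : Q i0 by rewrite /Q Ti0.
case: (Order.TotalTheory.arg_minP (fun i => f i / g i) Qi0) => k /andP[Tk gk] kmin.
exists (f k / g k); split.
- by rewrite divr_gt0 // fpos.
- move=> i Ti; have [gi|gi] := ltP 0 (g i).
    by rewrite -ler_pdivlMr // kmin // /Q Ti.
  apply: (@le_trans _ _ 0); last exact: f0.
  by rewrite mulr_ge0_le0 // divr_ge0 ?f0 // ltW.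
- by exists k; split=> //; rewrite divfK // gt_eqF.
Qed.

End Scalars.

(** * Vertices, extreme rays and edges *)

Section Dot.
Context {R : realType} {d : nat}.
Implicit Types (q : 'rV[R]_d) (p : 'cV[R]_d).

Definition dot q p : R := (q *m p) 0 0.

Lemma dotDl q1 q2 p : dot (q1 + q2) p = dot q1 p + dot q2 p.
Proof. by rewrite /dot mulmxDl mxE. Qed.
Lemma dotDr q p1 p2 : dot q (p1 + p2) = dot q p1 + dot q p2.
Proof. by rewrite /dot mulmxDr mxE. Qed.
Lemma dotZl k q p : dot (k *: q) p = k * dot q p.
Proof. by rewrite /dot -scalemxAl mxE. Qed.
Lemma dotZr k q p : dot q (k *: p) = k * dot q p.
Proof. by rewrite /dot -scalemxAr mxE. Qed.
Lemma dot0l p : dot 0 p = 0.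
Proof. by rewrite /dot mul0mx mxE. Qed.
Lemma dot0r q : dot q 0 = 0.
Proof. by rewrite /dot mulmx0 mxE. Qed.
Lemma dotBr q p1 p2 : dot q (p1 - p2) = dot q p1 - dot q p2.
Proof. by rewrite /dot mulmxBr !mxE. Qed.
Lemma dot_suml I (s : seq I) (Q : pred I) (F : I -> 'rV[R]_d) p :
  dot (\sum_(i <- s | Q i) F i) p = \sum_(i <- s | Q i) dot (F i) p.
Proof. by rewrite /dot mulmx_suml summxE. Qed.

End Dot.

Section Polytope.
Context {R : realType} {m d : nat} (A : 'M[R]_(m, d)) (b : 'cV[R]_m).
Implicit Types (q : 'rV[R]_d) (p w x z : 'cV[R]_d) (T : pred 'I_m).

Let a i : 'rV[R]_d := row i A.

Definition hpolyhedron : set 'cV[R]_d :=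
  [set x | forall i, (A *m x) i 0 <= b i 0].
Let P := hpolyhedron.

Lemma dot_row i x : dot (row i A) x = (A *m x) i 0.
Proof. by rewrite /dot -row_mul mxE. Qed.

Lemma hpolyhedronP x : P x <-> forall i, dot (a i) x <= b i 0.
Proof. by split=> h i; move: (h i); rewrite dot_row. Qed.

Definition tight w : pred 'I_m := fun i => dot (a i) w == b i 0.

(** The rows in T have rank d, stated through their common kernel. *)
Definition pinned T := forall z, (forall i, T i -> dot (a i) z = 0) -> z = 0.

(** Zeroing the rows outside T gives a matrix of full rank; a nonzero maximal
    minor of it cannot involve a zeroed row. *)
Lemma pinned_basis T : pinned T ->
  exists f : 'I_d -> 'I_m, (forall k, T (f k)) /\ \det (rowsub f A) != 0.
Proof.
move=> pT; pose N := \matrix_(i, j) (if T i then A i j else 0) : 'M[R]_(m, d).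
have fN : row_full N.
  rewrite /row_full -mxrank_tr; apply: inj_row_free => v vN.
  suff: v^T = 0 by move=> h; rewrite -[v]trmxK h trmx0.
  apply: pT => i Ti.
  have: (v *m N^T) 0 i = 0 by rewrite vN mxE.
  rewrite dot_row !mxE => {2}<-; apply: eq_bigr => j _.
  by rewrite !mxE Ti mulrC.
exists (fullrankfun fN).
have dN : \det (rowsub (fullrankfun fN) N) != 0.
  by rewrite -unitfE; have := fullrowsub_unit fN; rewrite unitmxE.
have Tf k : T (fullrankfun fN k).
  apply: contraNT dN => nT; apply/eqP.
  rewrite (expand_det_row _ k); apply: big1 => j _.
  by rewrite !mxE (negbTE nT) mul0r.
split=> //; suff <- : rowsub (fullrankfun fN) N = rowsub (fullrankfun fN) A by [].
by apply/matrixP => i j; rewrite !mxE Tf.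
Qed.

(** The sum of the rows in T is a supporting functional: it reaches the sum of
    the right-hand sides only where every constraint in T is tight. *)
Lemma is_face_tight T : is_face P (P `&` [set x | forall i, T i -> tight x i]).
Proof.
exists (\sum_(i | T i) a i), (\sum_(i | T i) b i 0).
have le x : P x -> forall i, T i -> dot (a i) x <= b i 0 by move=> /hpolyhedronP.
split=> [x Px|]; first by rewrite -/(dot _ x) dot_suml; apply: ler_sum; exact: le.
apply/seteqP; split=> x [Px /= Tx]; split=> //=.
  by rewrite -/(dot _ x) dot_suml; apply: eq_bigr => i /Tx /eqP.
move: Tx; rewrite -/(dot _ x) dot_suml => /eqP.
rewrite -subr_eq0 -sumrB -oppr_eq0 -sumrN psumr_eq0; last first.
  by move=> i Ti; rewrite opprB subr_ge0 le.
move=> /allP h i Ti; have := h i (mem_index_enum _).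
by rewrite Ti /= oppr_eq0 subr_eq0.
Qed.

(** If the tight rows had a common kernel vector z, then w + e z and w - e z
    would both lie in P for small e, and no functional could expose w alone. *)
Lemma vertexP w : vertices P w <-> P w /\ pinned (tight w).
Proof.
split=> [[c [delta [cle cw]]]|[Pw pw]].
  have [Pw cwd] : (P `&` [set x | (c *m x) 0 0 = delta]) w by rewrite -cw.
  split=> // z zT.
  pose f i := if tight w i then 1 else b i 0 - dot (a i) w.
  have [|e e0 he] := @small_step _ _ f (fun i => dot (a i) z).
    move=> i; rewrite /f /tight; case: ifP => // /negbT ne.
    by rewrite subr_gt0 lt_neqAle ne; move/hpolyhedronP: Pw; apply.
  have step s : `|s| = 1 -> P (w + (s * e) *: z).
    move=> s1; apply/hpolyhedronP => i; rewrite dotDr dotZr.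
    case: (boolP (tight w i)) => [ti|nt].
      by rewrite zT // mulr0 addr0 (eqP ti).
    have := he i; rewrite /f (negbTE nt) => h.
    rewrite -lerBrDl; apply: (le_trans (ler_norm _)).
    by rewrite !normrM s1 mul1r (gtr0_norm e0).
  have h1 := cle _ (step 1 (normr1 _)).
  have h2 := cle _ (step (-1) (normrN1 _)).
  move: h1 h2 cwd; rewrite -!/(dot _ _) !dotDr !dotZr /= -!/(dot _ _) => h1 h2 h3.
  have cz : e * dot c z = 0 by lra.
  have : [set w] (w + (1 * e) *: z).
    rewrite cw; split; first by apply: step; rewrite normr1.
    by rewrite /= -!/(dot _ _) dotDr dotZr mul1r cz addr0.
  rewrite /= mul1r => /eqP; rewrite addrC -subr_eq0 addrK scaler_eq0 gt_eqF //=.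
  by move/eqP.
rewrite /vertices /=.
suff -> : [set w] = P `&` [set x | forall i, tight w i -> tight x i].
  exact: is_face_tight.
apply/seteqP; split=> [x -> |x [Px /= Tx]] /=; first by split.
suff : x - w = 0 by move=> /eqP; rewrite subr_eq0 => /eqP.
apply: pw => i ti.
by rewrite dotBr (eqP ti) (eqP (Tx i ti)) subrr.
Qed.

(** z spans an extreme ray of the cone cut out by the rows in T: the rows of T
    orthogonal to z leave no other direction free. *)
Definition extreme_ray T z :=
  [/\ z != 0, forall i, T i -> dot (a i) z <= 0 &
   forall y, (forall i, T i -> dot (a i) z = 0 -> dot (a i) y = 0) ->
     exists k, y = k *: z].

Lemma extreme_rayZ T k z : 0 < k -> extreme_ray T z -> extreme_ray T (k *: z).
Proof.
move=> k0 [z0 zle zsp]; split.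
- by rewrite scaler_eq0 gt_eqF.
- by move=> i Ti; rewrite dotZr pmulr_rle0 // zle.
- move=> y yT; have [|l ->] := zsp y.
    by move=> i Ti zi; apply: yT; rewrite // dotZr zi mulr0.
  by exists (l / k); rewrite scalerA divfK // gt_eqF.
Qed.

Inductive ray_sum T : 'cV[R]_d -> Prop :=
| ray_sum0 : ray_sum T 0
| ray_sumD z x : extreme_ray T z -> ray_sum T x -> ray_sum T (z + x).

Lemma ray_sum_add T x y : ray_sum T x -> ray_sum T y -> ray_sum T (x + y).
Proof.
move=> + Ty; elim=> [|z {}x ez _ ih]; first by rewrite add0r.
by rewrite -addrA; apply: ray_sumD.
Qed.

Lemma ray_sumZ T k x : 0 < k -> ray_sum T x -> ray_sum T (k *: x).
Proof.
move=> k0; elim=> [|z {}x ez _ ih]; first by rewrite scaler0; apply: ray_sum0.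
by rewrite scalerDr; apply: ray_sumD => //; apply: extreme_rayZ.
Qed.

(** A cone containing no line is generated by its extreme rays.  Through a
    vector that is not extreme there is a line, of constant height for the sum of
    the rows, inside the same face; the line leaves the cone on both sides, and
    the vector is a convex combination of the two exit points, each of which has
    one more constraint tight. *)
Lemma cone_ray_sum T x : pinned T -> (forall i, T i -> dot (a i) x <= 0) ->
  ray_sum T x.
Proof.
move=> pT; have [n] := ubnP #|[pred i | T i && (dot (a i) x != 0)]|.
elim: n x => // n ih x; rewrite ltnS => xn xle.
have [->|x0] := eqVneq x 0; first exact: ray_sum0.
case: (pselect (extreme_ray T x)) => [ex|nex].
  by rewrite -[x]addr0; apply: ray_sumD => //; apply: ray_sum0.
have [y yT ynx] : exists2 y, (forall i, T i -> dot (a i) x = 0 -> dot (a i) y = 0)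
    & ~ exists k, y = k *: x.
  apply: contrapT => h; apply: nex; split=> // y yT.
  by apply: contrapT => hy; apply: h; exists y.
pose h x := \sum_(i | T i) dot (a i) x.
have sum_neg u : u != 0 -> (forall i, T i -> dot (a i) u <= 0) -> h u < 0.
  move=> u0 ule; rewrite lt_neqAle; apply/andP; split; last exact: sumr_le0.
  apply: contraNneq u0 => hu0; apply/eqP/pT => i Ti.
  move/eqP: hu0; rewrite -oppr_eq0 -sumrN psumr_eq0; last first.
    by move=> j Tj; rewrite oppr_ge0 ule.
  move=> /allP /(_ i (mem_index_enum _)).
  by rewrite Ti /= oppr_eq0 => /eqP.
have hx : h x < 0 by exact: sum_neg.
have hlin k u v : h (u - k *: v) = h u - k * h v.
  rewrite /h mulr_sumr -sumrB; apply: eq_bigr => i _.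
  by rewrite dotBr dotZr.
pose y' := y - (h y / h x) *: x.
have y'T i : T i -> dot (a i) x = 0 -> dot (a i) y' = 0.
  by move=> Ti xi; rewrite /y' dotBr dotZr xi (yT i) // mulr0 subrr.
have y'0 : y' != 0.
  by apply/eqP => /eqP; rewrite subr_eq0 => /eqP e; apply: ynx; exists (h y / h x).
have hy' : h y' = 0 by rewrite hlin divfK ?subrr // lt_eqF.
(* A ray from x along y' or -y' cannot stay in the cone, where only 0 has
   height 0; it is blocked by a constraint that is slack at x. *)
have walkto s : `|s| = 1 -> exists2 t, 0 < t & ray_sum T (x + (t * s) *: y').
  move=> s1.
  have s0 : s != 0 by apply/eqP => h0; move: s1; rewrite h0 normr0; lra.
  have [|||t [t0 tle [k [Tk gk tk]]]] := @ratio_test _ _ T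
      (fun i => - dot (a i) x) (fun i => dot (a i) (s *: y')).
  - by move=> i Ti; rewrite oppr_ge0 xle.
  - move=> i Ti gi; have := xle i Ti; rewrite le_eqVlt oppr_gt0 => /orP[/eqP xi|//].
    by move: gi; rewrite dotZr y'T // mulr0 ltxx.
  - apply: contrapT => no.
    have : h (s *: y') < 0.
      apply: sum_neg; first by rewrite scaler_eq0 negb_or s0.
      by move=> i Ti; rewrite leNgt; apply/negP => gi; apply: no; exists i.
    have -> : s *: y' = 0 - (- s) *: y' by rewrite scaleNr opprK add0r.
    rewrite hlin hy' mulr0 subr0 /h big1 ?ltxx // => i _.
    exact: dot0r.
  exists t => //; rewrite -scalerA; apply: ih; last first.
    by move=> i Ti; rewrite dotDr dotZr; have := tle i Ti; lra.
  apply: leq_trans xn; apply: proper_card; apply/properP; split.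
    apply/fintype.subsetP => i; rewrite !inE => /andP[Ti].
    rewrite Ti /= => h1; apply: contra h1 => /eqP xi.
    by rewrite dotDr !dotZr xi y'T // !mulr0 addr0.
  exists k; rewrite !inE Tk /=.
    by apply: contraTneq gk => xk; rewrite dotZr y'T // mulr0 ltxx.
  by rewrite negbK dotDr [dot _ (t *: _)]dotZr tk subrr.
have [t1 t10 r1] := walkto 1 (normr1 _).
have [t2 t20 r2] := walkto (-1) (normrN1 _).
have t12 : 0 < t1 + t2 by lra.
have -> : x = (t2 / (t1 + t2)) *: (x + (t1 * 1) *: y') +
              (t1 / (t1 + t2)) *: (x + (t2 * -1) *: y').
  apply/matrixP => i j; rewrite !mxE.
  by field; lra.
by apply: ray_sum_add; apply: ray_sumZ => //; apply: divr_gt0.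
Qed.

Lemma vertex_ray_sum w p : vertices P w -> P p -> ray_sum (tight w) (p - w).
Proof.
move=> /vertexP[Pw pw] /hpolyhedronP Pp; apply: cone_ray_sum => // i /eqP ti.
by rewrite dotBr ti subr_le0.
Qed.

(** An extreme ray at a vertex is followed up to the first blocking constraint;
    the rows orthogonal to it expose the segment travelled as an edge. *)
Lemma extreme_ray_adj w z : (forall u, u != 0 -> exists i, 0 < dot (a i) u) ->
  vertices P w -> extreme_ray (tight w) z ->
  exists2 t, 0 < t & vertex_adj P w (w + t *: z).
Proof.
move=> norec Vw [z0 zle zsp]; have [/hpolyhedronP Pw pw] := (vertexP w).1 Vw.
have [|||t [t0 tle [k [_ gk tk]]]] := @ratio_test _ _ predT
   (fun i => b i 0 - dot (a i) w) (fun i => dot (a i) z).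
- by move=> i _; rewrite subr_ge0.
- move=> i _ gi; rewrite subr_gt0 lt_neqAle Pw andbT.
  by apply: contraTN gi => ti; rewrite -leNgt zle.
- by have [i] := norec z z0; exists i.
exists t => //.
have Pw' : P (w + t *: z).
  by apply/hpolyhedronP => i; rewrite dotDr dotZr; have := tle i isT; lra.
have Vw' : vertices P (w + t *: z).
  apply/vertexP; split=> // y yT.
  have [|c ycz] := zsp y.
    by move=> i /eqP ti zi; apply: yT; rewrite /tight dotDr dotZr zi mulr0 addr0 ti.
  have : dot (a k) y = 0.
    by apply: yT; rewrite /tight dotDr dotZr tk addrC subrK.
  rewrite ycz dotZr => /eqP; rewrite mulf_eq0 (gt_eqF gk) orbF => /eqP ->.
  by rewrite scale0r.
have tz0 : t *: z != 0 by rewrite scaler_eq0 gt_eqF.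
split=> //.
  by move/eqP; rewrite eq_sym -subr_eq0 addrC addKr (negbTE tz0).
pose J i := tight w i && (dot (a i) z == 0).
exists (P `&` [set x | forall i, J i -> tight x i]).
have Fw : (P `&` [set x | forall i, J i -> tight x i]) w.
  by split; [apply/hpolyhedronP | move=> i /andP[]].
have Fw' : (P `&` [set x | forall i, J i -> tight x i]) (w + t *: z).
  split=> // i /andP[/eqP ti /eqP zi].
  by rewrite /tight dotDr dotZr zi mulr0 addr0 ti.
split=> //; first exact: is_face_tight.
exists w, (t *: z); split=> //.
- move=> j; suff -> : col j (t *: z) = t *: z by [].
  by apply/matrixP => i k'; rewrite !mxE (ord1 j) (ord1 k').
- apply/eqP; rewrite eqn_leq rank_leq_col lt0n mxrank_eq0 //.
- move=> x [_ /= xJ]; have [|c xc] := zsp (x - w).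
    move=> i ti zi; rewrite dotBr (eqP ti) (eqP (xJ i _)) ?subrr //.
    by rewrite /J ti zi eqxx.
  exists (c / t)%:M; rewrite mul_mx_scalar scalerA divfK ?gt_eqF // -xc.
  by rewrite addrC subrK.
Qed.

End Polytope.

(** * Edge directions and minors *)

Section Minors.
Context {R : realType} {m d : nat} (A : 'M[int]_(m, d)) (b : 'cV[int]_m).
Context {Delta : R} (minA : minors_bounded d (row_mx A b) Delta).
Implicit Types (z w : 'cV[R]_d).

Let AR : 'M[R]_(m, d) := Defs.realmx R A.
Let bR : 'cV[R]_m := Defs.realmx R b.
Let a i : 'rV[R]_d := row i AR.

Lemma increasing_reordering (f : 'I_d -> 'I_m) : injective f ->
  exists p : 'S_d, {homo (f \o p) : i j / (i < j)%N}.
Proof.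
move=> finj; pose t := [tuple nat_of_ord (f k) | k < d].
have /tuple_permP[p ep] : perm_eq (sort leq t) t by rewrite perm_sort.
exists p => i j ij /=.
have fpi (k : 'I_d) : nat_of_ord (f (p k)) = nth 0%N (sort leq t) k.
  by rewrite ep -[X in nth _ X]/(tval _) -tnth_nth tnth_mktuple tnth_mktuple.
rewrite ltn_neqAle; apply/andP; split.
  apply: contraTneq ij => /val_inj /finj /perm_inj ->.
  by rewrite ltnn.
rewrite !fpi; apply: (sorted_leq_nth leq_trans leqnn) => //.
- by apply: sort_sorted; exact: leq_total.
- by rewrite inE size_sort size_tuple.
- by rewrite inE size_sort size_tuple.
- exact: ltnW.
Qed.

(** The bound on minors speaks of increasing choices of rows; reordering the rows
    only changes the sign of the determinant. *)
Lemma det_rowsub_le (f : 'I_d -> 'I_m) : \det (rowsub f A) != 0 ->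
  `|(\det (rowsub f A))%:~R| <= Delta.
Proof.
move=> det0; have finj : injective f.
  move=> i j fij; apply: contraNeq det0 => ij; apply/eqP.
  by apply: (determinant_alternate ij) => k; rewrite !mxE fij.
have [p fp] := increasing_reordering finj.
have := minA fp (fun i j ij => ij : (lshift 1 i < lshift 1 j)%N).
have -> : mxsub (f \o p) (lshift 1) (row_mx A b) = row_perm p (rowsub f A).
  by apply/matrixP => i j; rewrite !mxE (unsplitK (inl j)) /=.
by rewrite row_permE det_mulmx det_perm rmorphM rmorph_sign normrM normrX normrN1 expr1n mul1r.
Qed.

Lemma det_realmx (f : 'I_d -> 'I_m) :
  \det (rowsub f AR) = (\det (rowsub f A))%:~R.
Proof. by rewrite -det_map_mx; congr (\det _); apply/matrixP => i j; rewrite !mxE. Qed.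

Lemma minor_bound_ge1 (f : 'I_d -> 'I_m) :
  \det (rowsub f AR) != 0 -> 1 <= Delta.
Proof.
rewrite det_realmx intr_eq0 => det0; apply: le_trans (det_rowsub_le det0).
rewrite -intr_norm (ler_int R 1); lia.
Qed.

(** Take a row i0 tight at w but not orthogonal to z, and complete it by rows
    orthogonal to z into a basis N.  Then z is proportional to the vector of
    cofactors of N along the row i0, whose product with a row r of A is the minor
    obtained from N by putting r in place of i0. *)
Lemma extreme_ray_integral w z : pinned AR (tight AR bR w) ->
  extreme_ray AR (tight AR bR w) z ->
  exists2 mu, 0 < mu &
    forall r, exists2 k : int, dot (a r) (mu *: z) = k%:~R & `|k%:~R| <= Delta.
Proof.
move=> pw [z0 _ zsp].
have [i0 ti0 ai0] : exists2 i, tight AR bR w i & dot (a i) z != 0.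
  apply: contrapT => no; move/eqP: z0; apply; apply: pw => i ti.
  by apply/eqP/negPn/negP => h; apply: no; exists i.
(* The rows orthogonal to z leave only the line of z free, and i0 excludes
   that line. *)
pose T i := (tight AR bR w i && (dot (a i) z == 0)) || (i == i0).
have pT : pinned AR T.
  move=> y yT; have [|k yk] := zsp y.
    by move=> i ti zi; apply: yT; rewrite /T ti zi eqxx.
  have : dot (a i0) y = 0 by apply: yT; rewrite /T eqxx orbT.
  rewrite yk dotZr => /eqP; rewrite mulf_eq0 (negbTE ai0) orbF => /eqP ->.
  by rewrite scale0r.
have [f [fT detf]] := pinned_basis pT.
have D1 : 1 <= Delta := minor_bound_ge1 detf.
set N := rowsub f AR in detf.
have Nz k : (N *m z) k 0 = dot (a (f k)) z.
  by rewrite dot_row !mxE; apply: eq_bigr => j _; rewrite !mxE.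
have [k0 fk0] : exists k0, f k0 = i0.
  apply: contrapT => no; move/eqP: z0; apply.
  have uN : N \in unitmx by rewrite unitmxE unitfE.
  rewrite -[z](mulKmx uN); suff -> : N *m z = 0 by rewrite mulmx0.
  apply/matrixP => k j; rewrite (ord1 j) Nz mxE.
  have /orP[/andP[_ /eqP //]|/eqP fk] := fT k.
  by case: no; exists k.
have fk k : k != k0 -> dot (a (f k)) z = 0.
  move=> kk0; have /orP[/andP[_ /eqP //]|/eqP fki] := fT k.
  move: detf; rewrite (determinant_alternate kk0) ?eqxx // => j.
  by rewrite !mxE fki fk0.
set al := dot (a i0) z in ai0.
have cof j : \det N * z j 0 = al * cofactor N k0 j.
  have /matrixP/(_ j 0) := congr1 (fun X => X *m z) (mul_adj_mx N).
  rewrite -mulmxA mul_scalar_mx [RHS]mxE => <-.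
  rewrite mxE (bigD1 k0) //= big1 ?addr0.
    by rewrite Nz fk0 mxE mulrC.
  by move=> k kk0; rewrite Nz fk // mulr0.
pose fr r k := if k == k0 then r else f k.
have Dr r : \det N * dot (a r) z = al * \det (rowsub (fr r) AR).
  rewrite [\det (rowsub (fr r) AR)](expand_det_row _ k0) mulr_sumr dot_row mxE mulr_sumr.
  apply: eq_bigr => j _; rewrite mulrCA cof mulrCA; congr (_ * (_ * _)).
    by rewrite !mxE /fr eqxx.
  congr (_ * \det _); apply/matrixP => i l; rewrite !mxE /fr.
  by rewrite eq_sym (negbTE (neq_lift k0 i)).
have drle r : `|(\det (rowsub (fr r) A))%:~R| <= Delta.
  have [->|nz] := eqVneq (\det (rowsub (fr r) A)) 0; first by rewrite normr0; lra.
  exact: det_rowsub_le.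
exists (`|\det N| / `|al|); first by rewrite divr_gt0 ?normr_gt0.
move=> r; have eqr : dot (a r) z = al * (\det (rowsub (fr r) A))%:~R / \det N.
  by rewrite -det_realmx -Dr mulrAC divff ?mul1r.
have scale s : `|\det N| / `|al| = s * (\det N / al) ->
    dot (a r) ((`|\det N| / `|al|) *: z) = s * (\det (rowsub (fr r) A))%:~R.
  by move=> es; rewrite dotZr eqr es; field; apply/andP.
have [k [e le]] : exists s : int, `|\det N| / `|al| = s%:~R * (\det N / al) /\
    `|s%:~R : R| = 1.
  move: detf ai0; rewrite !neq_lt => /orP[h|h] /orP[h'|h'].
  - exists 1; rewrite rmorph1 normr1 (ltr0_norm h) (ltr0_norm h'); split => //.
    by field; lra.
  - exists (-1); rewrite rmorphN1 normrN1 (ltr0_norm h) (gtr0_norm h'); split => //.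
    by field; lra.
  - exists (-1); rewrite rmorphN1 normrN1 (gtr0_norm h) (ltr0_norm h'); split => //.
    by field; lra.
  - exists 1; rewrite rmorph1 normr1 (gtr0_norm h) (gtr0_norm h'); split => //.
    by field; lra.
exists (k * \det (rowsub (fr r) A)); rewrite rmorphM /=; first exact: scale.
by rewrite normrM le mul1r.
Qed.

(** The d products of the basis rows with the scaled ray are nonpositive
    integers, not all zero: this is where the integrality of A enters. *)
Lemma extreme_ray_push w z (f : 'I_d -> 'I_m) :
  (forall k, tight AR bR w (f k)) -> \det (rowsub f AR) != 0 ->
  extreme_ray AR (tight AR bR w) z ->
  exists2 mu, 0 < mu & (forall r, `|dot (a r) (mu *: z)| <= Delta) /\
    dot (\sum_k a (f k)) (mu *: z) <= -1.
Proof.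
move=> fT detf ez.
have kerf y : (forall k, dot (a (f k)) y = 0) -> y = 0.
  move=> fy; have uN : rowsub f AR \in unitmx by rewrite unitmxE unitfE.
  rewrite -[y](mulKmx uN); suff -> : rowsub f AR *m y = 0 by rewrite mulmx0.
  apply/matrixP => k j; rewrite (ord1 j) [RHS]mxE -(fy k) dot_row !mxE.
  by apply: eq_bigr => l _; rewrite !mxE.
have pw : pinned AR (tight AR bR w) by move=> y yT; apply: kerf => k; apply: yT.
have [mu mu0 zint] := extreme_ray_integral pw ez.
have [z0 zle _] := ez.
exists mu => //; split; first by move=> r; have [k -> ] := zint r.
have zle' k : dot (a (f k)) (mu *: z) <= 0 by rewrite dotZr pmulr_rle0 // zle.
have [k0 k0n] : exists k, dot (a (f k)) (mu *: z) != 0.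
  apply: contrapT => no.
  have : mu *: z = 0.
    by apply: kerf => k; apply/eqP/negPn/negP => h; apply: no; exists k.
  by move/eqP; rewrite scaler_eq0 gt_eqF // (negbTE z0).
rewrite dot_suml (bigD1 k0) //=.
have : dot (a (f k0)) (mu *: z) <= -1.
  move: (zle' k0) k0n; have [k -> _] := zint (f k0).
  rewrite -[0]/(0%:~R) -[-1]/((-1)%:~R) !ler_int eqr_int; lia.
have : \sum_(i < d | i != k0) dot (a (f i)) (mu *: z) <= 0.
  by apply: sumr_le0.
lra.
Qed.

End Minors.

(** * Walks in finite connected sets *)

Section Walks.
Context {T : eqType} (adj : T -> T -> Prop).

Lemma walk_rcons n u v x : walk adj n u v -> adj v x -> walk adj n.+1 u x.
Proof.
move=> [p [p0 pn pi]] avx; exists (fun i => if (i <= n)%N then p i else x).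
rewrite leq0n ltnn; split=> // i; rewrite ltnS => lein.
rewrite lein; case: ltnP => h; first exact: pi.
suff -> : i = n by rewrite pn.
by apply/eqP; rewrite eqn_leq lein.
Qed.

(** The set of vertices reached grows by at least one at each step until it
    fills U. *)
Lemma connected_walk (U : seq T) u : uniq U -> u \in U ->
  (forall L : pred T, (exists2 x, x \in U & L x) -> (exists2 y, y \in U & ~~ L y) ->
     exists x y, [/\ x \in U, y \in U, L x, ~~ L y & adj x y]) ->
  forall v, v \in U -> exists2 k, (k < size U)%N & walk adj k u v.
Proof.
move=> uU uinU cut.
have grow n : (n < size U)%N -> exists L : seq T,
    [/\ uniq L, {subset L <= U}, size L = n.+1, u \in L &
        forall v, v \in L -> exists2 k, (k <= n)%N & walk adj k u v].
  elim: n => [|n ih] lt.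
    exists [:: u]; split; rewrite ?mem_head //.
      by move=> x; rewrite inE => /eqP ->.
    by move=> v; rewrite inE => /eqP ->; exists 0%N => //; exists (fun=> u).
  have [L [uL LU sL uinL wL]] := ih (ltnW lt).
  have [y yU yL] : exists2 y, y \in U & y \notin L.
    have /allPn[y yU yL] : ~~ all (mem L) U; last by exists y.
    apply/negP => /allP UL; have := uniq_leq_size uU UL; rewrite sL; lia.
  have [||x [z [xU zU xL zL axz]]] := cut (mem L).
  - by exists u.
  - by exists y.
  exists (z :: L); split=> //.
  - by rewrite /= zL.
  - by move=> v; rewrite inE => /orP[/eqP ->//|/LU].
  - by rewrite /= sL.
  - by rewrite inE uinL orbT.
  - move=> v; rewrite inE => /orP[/eqP ->|/wL[k kn w]]; last by exists k => //; lia.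
    by have [k kn w] := wL x xL; exists k.+1 => //; apply: walk_rcons w _.
move=> v vU; have U0 : (0 < size U)%N by case: (U) uinU.
have [|L [uL LU sL _ wL]] := grow (size U).-1; first by rewrite prednK.
have [] := uniq_min_size uL LU; first by rewrite sL prednK.
move=> _ LUe; have [|k kn w] := wL v; first by rewrite LUe.
by exists k => //; lia.
Qed.

End Walks.

(** * Vertices optimal along a segment of objectives *)

(** Taking one of the values as the default makes the maximum attained. *)
Lemma bigmax_attained (R : realType) (I : eqType) (V : seq I) (L : pred I)
    (f : I -> R) w1 : w1 \in V -> L w1 ->
  exists w, [/\ w \in V, L w & \big[Num.max/f w1]_(w <- V | L w) f w = f w].
Proof.
move=> w1V Lw1.
suff: forall W : seq I, {subset W <= V} -> exists w,
    [/\ w \in V, L w & \big[Num.max/f w1]_(w <- W | L w) f w = f w].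
  by apply.
elim=> [|x W ih] WV; first by exists w1; rewrite big_nil.
have [|w [wV Lw e]] := ih; first by move=> y yW; apply: WV; rewrite inE yW orbT.
rewrite big_cons; case: ifP => Lx; last by exists w.
rewrite e; case: (leP (f x) (f w)) => h; [by exists w|exists x; split=> //].
by apply: WV; rewrite mem_head.
Qed.

Lemma le_bigmax_real (R : realType) (I : eqType) (V : seq I) (L : pred I)
    (f : I -> R) x w : w \in V -> L w ->
  f w <= \big[Num.max/x]_(w <- V | L w) f w.
Proof. by move=> wV Lw; apply: le_bigmax_seq. Qed.

Lemma bigmax_continuous (R : realType) (I : eqType) (V : seq I) (L : pred I)
    (f : I -> R -> R) w1 : (forall w, continuous (f w)) ->
  continuous (fun s => \big[Num.max/f w1 s]_(w <- V | L w) f w s).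
Proof.
move=> fc; elim: V => [|x W ih].
  by under eq_fun do rewrite big_nil; exact: fc.
under eq_fun do rewrite big_cons.
case: (L x) => //.
by move=> s; apply: continuous_max; [exact: fc|exact: ih].
Qed.

Section Optima.
Context {R : realType} {m d : nat} (A : 'M[R]_(m, d)) (b : 'cV[R]_m).
Implicit Types (q : 'rV[R]_d) (p w x z : 'cV[R]_d).

Let P := hpolyhedron A b.
Let a i : 'rV[R]_d := row i A.
Let ray w := extreme_ray A (tight A b w).
Hypothesis norec : forall u : 'cV[R]_d, u != 0 -> exists i, 0 < dot (a i) u.

Definition optimal q w := P w /\ forall p, P p -> dot q p <= dot q w.

Lemma optimal_ray q w z : vertices P w -> optimal q w -> ray w z -> dot q z <= 0.
Proof.
move=> Vw [Pw wopt] ez; have [t t0 [_ /vertexP[Pw' _] _ _]] := extreme_ray_adj norec Vw ez.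
by have := wopt _ Pw'; rewrite dotDr dotZr gerDl pmulr_rle0.
Qed.

Lemma rays_optimal q w : vertices P w -> (forall z, ray w z -> dot q z <= 0) ->
  optimal q w.
Proof.
move=> Vw le; split=> [|p Pp]; first by have [] := (vertexP A b w).1 Vw.
suff: dot q (p - w) <= 0 by rewrite dotBr subr_le0.
elim: (vertex_ray_sum Vw Pp) => [|z x ez _ ih]; first by rewrite dot0r.
by rewrite dotDr; have := le z ez; lra.
Qed.

(** Interior points of the normal cone of w. *)
Lemma rays_unique_optimal q w p : vertices P w ->
  (forall z, ray w z -> dot q z < 0) -> optimal q p -> p = w.
Proof.
move=> Vw lt [Pp popt].
have [Pw _] := (vertexP A b w).1 Vw.
suff: p - w = 0 \/ dot q (p - w) < 0.
  case=> [/eqP|]; first by rewrite subr_eq0 => /eqP.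
  by rewrite dotBr subr_lt0 ltNge popt.
elim: (vertex_ray_sum Vw Pp) => [|z x ez _ ih]; first by left.
right; rewrite dotDr; have := lt z ez.
by case: ih => [->|]; rewrite ?dot0r; lra.
Qed.

(** A vertex is determined by the set of its tight constraints. *)
Lemma finite_vertices : exists V : seq 'cV[R]_d,
  uniq V /\ forall w, w \in V <-> vertices P w.
Proof.
suff /finite_seqP[V eV] : finite_set (vertices P).
  exists (undup V); split; first exact: undup_uniq.
  by move=> w; rewrite mem_undup eV.
pose g (S : {set 'I_m}) : 'cV[R]_d :=
  xget 0 [set w | vertices P w /\ S = [set i | tight A b w i]%SET].
apply: (@sub_finite_set _ _ (g @` setT)); last first.
  exact/finite_image/finite_finset.
move=> w Vw; exists [set i | tight A b w i]%SET => //.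
rewrite /g; case: xgetP => [w' _ [Vw' e]|/(_ w)]; last by case.
have [_ pw] := (vertexP A b w).1 Vw.
suff : w' - w = 0 by move/eqP; rewrite subr_eq0 => /eqP.
apply: pw => i ti.
have ti' : tight A b w' i by move/setP/(_ i): e; rewrite !inE ti => <-.
by rewrite dotBr (eqP ti) (eqP ti') subrr.
Qed.

(** Being at least as good as the neighbours already makes a vertex optimal: every edge
    direction leads to a neighbour. *)
Lemma best_vertex_optimal q w : vertices P w ->
  (forall w', vertices P w' -> dot q w' <= dot q w) -> optimal q w.
Proof.
move=> Vw best; apply: rays_optimal => // z ez.
have [t t0 [_ Vw' _ _]] := extreme_ray_adj norec Vw ez.
by have := best _ Vw'; rewrite dotDr dotZr gerDl pmulr_rle0.
Qed.

Lemma optimal_vertex_exists q : (exists w, vertices P w) ->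
  exists2 w, vertices P w & optimal q w.
Proof.
move=> [w0 Vw0]; have [V [_ VP]] := finite_vertices.
have w0V : w0 \in V by apply/VP.
have [w [wV _ e]] := @bigmax_attained _ _ V predT (dot q) w0 w0V isT.
exists w; first exact/VP.
apply: best_vertex_optimal => [|w' /VP w'V]; first exact/VP.
by rewrite -e; apply: le_bigmax_seq.
Qed.

(** The vertices of the optimal face form a connected graph.  Let l expose w2,
    and let w0 be the best vertex for l among the optimal ones in L.  On the way
    from w0 to w2 some edge of the optimal face increases l, and its other end
    cannot be in L. *)
Lemma optimal_face_cut q (L : pred 'cV[R]_d) w1 w2 :
  vertices P w1 -> optimal q w1 -> L w1 -> vertices P w2 -> optimal q w2 -> ~~ L w2 ->
  exists x y, [/\ vertices P x /\ optimal q x, vertices P y /\ optimal q y, L x,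
    ~~ L y & vertex_adj P x y].
Proof.
move=> Vw1 opt1 L1 Vw2 opt2 L2; have [V [_ VP]] := finite_vertices.
have [l [delta [lle l2]]] := Vw2.
have [Pw2 lw2] : (P `&` [set x | (l *m x) 0 0 = delta]) w2 by rewrite -l2.
pose L' w := L w && `[< optimal q w >].
have L'1 : L' w1 by rewrite /L' L1; apply/asboolP.
have w1V : w1 \in V by apply/VP.
have [w0 [w0V /andP[L0 /asboolP opt0] e0]] := bigmax_attained (dot l) w1V L'1.
have Vw0 := (VP w0).1 w0V; have [Pw0 _] := opt0.
have lt02 : dot l w0 < dot l w2.
  rewrite lt_neqAle [dot l w2]lw2 lle // andbT; apply/eqP => h.
  suff : [set w2] w0 by move=> /= h'; move: L2; rewrite -h' L0.
  by rewrite l2.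
have eq02 : dot q w2 = dot q w0.
  by apply/eqP; rewrite eq_le opt2.2 // opt0.2.
have [z ez [qz lz]] : exists2 z, ray w0 z & dot q z = 0 /\ 0 < dot l z.
  have : dot q (w2 - w0) = 0 by rewrite dotBr eq02 subrr.
  have : 0 < dot l (w2 - w0) by rewrite dotBr subr_gt0.
  elim: (vertex_ray_sum Vw0 Pw2) => [|z x ez rx ih]; first by rewrite dot0r ltxx.
  have qle y : ray_sum A (tight A b w0) y -> dot q y <= 0.
    elim=> [|z' x' ez' _ ih']; first by rewrite dot0r.
    by rewrite dotDr; have := optimal_ray Vw0 opt0 ez'; lra.
  rewrite !dotDr => lzx qzx; have qz := optimal_ray Vw0 opt0 ez; have qx := qle _ rx.
  have qz0 : dot q z = 0 by lra.
  case: (ltP 0 (dot l z)) => lz; first by exists z.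
  by apply: ih; lra.
have [t t0 adj] := extreme_ray_adj norec Vw0 ez.
have [_ Vy _ _] := adj; have [Py _] := (vertexP A b _).1 Vy.
have opty : optimal q (w0 + t *: z).
  by split=> // p Pp; rewrite dotDr dotZr qz mulr0 addr0 opt0.2.
exists w0, (w0 + t *: z); split=> //.
apply/negP => Ly.
have : dot l (w0 + t *: z) <= dot l w0.
  by rewrite -e0; apply: le_bigmax_seq; [exact/VP|rewrite /L' Ly; apply/asboolP].
by rewrite dotDr dotZr gerDl pmulr_rle0 // leNgt lz.
Qed.

(** The vertices optimal somewhere on a segment form a connected graph.  The best
    value over the vertices in L and the best value over the others are continuous
    along the segment, and each of them is the larger one somewhere; where they
    agree, the optimal face has vertices of both kinds. *)
Lemma optimal_segment_cut q0 c (S : R) (L : pred 'cV[R]_d) s1 w1 s2 w2 :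
  0 <= s1 <= S -> vertices P w1 -> optimal (q0 + s1 *: c) w1 -> L w1 ->
  0 <= s2 <= S -> vertices P w2 -> optimal (q0 + s2 *: c) w2 -> ~~ L w2 ->
  exists s x y, [/\ 0 <= s <= S, vertices P x /\ optimal (q0 + s *: c) x,
    vertices P y /\ optimal (q0 + s *: c) y & L x /\ ~~ L y /\ vertex_adj P x y].
Proof.
move=> s1S V1 o1 L1 s2S V2 o2 L2; have [V [_ VP]] := finite_vertices.
have w1V : w1 \in V by apply/VP.
have w2V : w2 \in V by apply/VP.
pose f w (s : R) := dot (q0 + s *: c) w.
have fc w : continuous (f w).
  have -> : f w = fun s => dot q0 w + s * dot c w.
    by apply/funext => s; rewrite /f dotDl dotZl.
  by move=> s; apply: cvgD; [exact: cvg_cst|apply: cvgM; [exact: cvg_id|exact: cvg_cst]].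
pose F (K : pred (matrix R d 1)) w (s : R) := \big[Num.max/f w s]_(w <- V | K w) f w s.
have Fopt (K : pred 'cV[R]_d) w s u : w \in V -> K w -> optimal (q0 + s *: c) u -> F K w s <= f u s.
  move=> wV Kw [_ uo]; have [w' [w'V _]] := bigmax_attained (fun w => f w s) wV Kw.
  by rewrite /F => ->; apply: uo; have [] := (vertexP A b w').1 ((VP w').1 w'V).
have Fge (K : pred 'cV[R]_d) w s w' : w' \in V -> K w' -> f w' s <= F K w s.
  by move=> w'V Kw'; exact: (@le_bigmax_real _ _ V K (fun w => f w s)).
pose G (s : R) := F L w1 s - F (predC L) w2 s.
have Gc : continuous G.
  by move=> s; apply: cvgB; apply: bigmax_continuous.
have G1 : 0 <= G s1.
  rewrite subr_ge0; apply: (@le_trans _ _ (f w1 s1)); first exact: Fopt.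
  exact: Fge.
have G2 : G s2 <= 0.
  rewrite subr_le0; apply: (@le_trans _ _ (f w2 s2)); first exact: Fopt.
  exact: Fge.
have [s sS Gs] : exists2 s, 0 <= s <= S & G s = 0.
  have [le|le] := leP s1 s2.
    have [||s] := @IVT _ G s1 s2 0 le.
    - exact: continuous_subspaceT.
    - by rewrite ge_min le_max G1 G2 orbT.
    by rewrite in_itv /= => h e; exists s => //; lra.
  have [||s] := @IVT _ G s2 s1 0 (ltW le).
  - exact: continuous_subspaceT.
  - by rewrite ge_min le_max G1 G2 orbT.
  by rewrite in_itv /= => h e; exists s => //; lra.
have [x [xV Lx ex]] := bigmax_attained (fun w => f w s) w1V L1.
have [y [yV Ly ey]] := bigmax_attained (L := predC L) (fun w => f w s) w2V L2.
have exy : f x s = f y s by move/eqP: Gs; rewrite subr_eq0 /F ex ey => /eqP.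
have fle w : vertices P w -> f w s <= f x s.
  move=> /VP wV; have [Lw|Lw] := boolP (L w); first by rewrite -ex; apply: Fge.
  by rewrite exy -ey; apply: Fge.
have ox : optimal (q0 + s *: c) x by apply: best_vertex_optimal; [exact/VP|exact: fle].
have oy : optimal (q0 + s *: c) y.
  by apply: best_vertex_optimal; [exact/VP|rewrite -!/(f _ _) -exy; exact: fle].
have [x' [y' [h1 h2 h3 h4 h5]]] := optimal_face_cut ((VP x).1 xV) ox Lx ((VP y).1 yV) oy Ly.
by exists s, x', y'.
Qed.

End Optima.

(** * Sums of rows and their growth *)

Section RowSums.
Context {m d : nat} (A : 'M[int]_(m, d)).
Implicit Types (x y : 'rV[int]_d).

(** The distinct sums of at most n rows of A, with repetition. *)
Fixpoint row_sums n : seq 'rV[int]_d :=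
  if n is n'.+1 then
    undup [seq x + e | x <- row_sums n', e <- 0 :: [seq row i A | i <- enum 'I_m]]
  else [:: 0].

Lemma row_sums_uniq n : uniq (row_sums n).
Proof. by case: n => // n; apply: undup_uniq. Qed.

Lemma row_sumsS n x : reflect (exists2 y, y \in row_sums n &
    x = y \/ exists i, x = y + row i A) (x \in row_sums n.+1).
Proof.
have -> : (x \in row_sums n.+1) =
    (x \in [seq y + e | y <- row_sums n, e <- 0 :: [seq row i A | i <- enum 'I_m]]).
  by rewrite -[RHS]mem_undup.
apply: (iffP allpairsPdep) => [[y [e [yn]]]|[y yn]].
  rewrite inE => /orP[/eqP ->|/mapP[i _ ->]] ->; exists y => //.
    by left; rewrite addr0.
  by right; exists i.
case=> [->|[i ->]].
  by exists y, 0; split; rewrite ?mem_head ?addr0.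
exists y, (row i A); split=> //; rewrite inE; apply/orP; right.
by apply: map_f; rewrite mem_enum.
Qed.

Lemma row_sums_le k n : (k <= n)%N -> {subset row_sums k <= row_sums n}.
Proof.
move=> /subnK <-; elim: (n - k)%N => [//|l ih] x /ih h.
by rewrite addSn; apply/row_sumsS; exists x => //; left.
Qed.

Lemma row_sumsD n k x y : x \in row_sums n -> y \in row_sums k ->
  x + y \in row_sums (n + k).
Proof.
move=> xn; elim: k y => [|k ih] y.
  by rewrite inE => /eqP ->; rewrite addr0 addn0.
move=> /row_sumsS[z zk h]; rewrite addnS; apply/row_sumsS; exists (x + z); first exact: ih.
by case: h => [->|[i ->]]; [left|right; exists i; rewrite addrA].
Qed.

Lemma row_sums0 n : 0 \in row_sums n.
Proof. by apply: (@row_sums_le 0) => //; rewrite inE. Qed.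

Lemma sum_rows_mem k (f : 'I_k -> 'I_m) : \sum_i row (f i) A \in row_sums k.
Proof.
elim: k f => [|k ih] f; first by rewrite big_ord0 inE.
rewrite big_ord_recr /=; apply/row_sumsS.
by exists (\sum_(i < k) row (f (widen_ord (leqnSn k) i)) A); [exact: ih|right; exists (f ord_max)].
Qed.

Lemma row_sums_muln n t x : x \in row_sums n -> x *+ t \in row_sums (t * n).
Proof.
move=> xn; elim: t => [|t ih]; first by rewrite mulr0n inE.
by rewrite mulrS mulSn; apply: row_sumsD.
Qed.

Lemma size_row_sums_le k n : (k <= n)%N -> (size (row_sums k) <= size (row_sums n))%N.
Proof. by move=> kn; apply: uniq_leq_size (row_sums_uniq k) (row_sums_le kn). Qed.

Lemma size_row_sums_gt0 n : (0 < size (row_sums n))%N.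
Proof. by case: (row_sums n) (row_sums0 n). Qed.

Lemma row_sums_entry M n x j : (forall i j, (`|A i j| <= M)%N) ->
  x \in row_sums n -> (`|x 0%R j| <= n * M)%N.
Proof.
move=> AM; elim: n x => [|n ih] x; first by rewrite inE => /eqP ->; rewrite mxE.
move=> /row_sumsS[y /ih yn [->|[i ->]]]; first by apply: leq_trans yn _; rewrite leq_mul2r leqnSn orbT.
rewrite !mxE mulSn addnC; move: yn (AM i j).
move: (y _ j) (A i j) (n * M)%N => u v k; lia.
Qed.

Lemma size_row_sums M n : (forall i j, (`|A i j| <= M)%N) ->
  (size (row_sums n) <= (2 * (n * M) + 1) ^ d)%N.
Proof.
move=> AM; pose N := (2 * (n * M))%N.
pose g (x : 'rV[int]_d) : {ffun 'I_d -> 'I_N.+1} :=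
  [ffun j => inord `|(x 0%R j + (n * M)%:Z)%R|%N].
have ginj : {in row_sums n &, injective g}.
  move=> x y xn yn /ffunP gxy; apply/matrixP => i j; rewrite (ord1 i).
  have := gxy j; rewrite !ffunE => /(congr1 (@nat_of_ord _)).
  have := row_sums_entry j AM xn; have := row_sums_entry j AM yn.
  by move=> h1 h2; rewrite !inordK; rewrite /N; lia.
rewrite -(size_map g) addn1.
have <- : #|{: {ffun 'I_d -> 'I_N.+1}}| = (N.+1 ^ d)%N by rewrite card_ffun !card_ord.
by rewrite cardE; apply: uniq_leq_size; [rewrite map_inj_in_uniq // row_sums_uniq|move=> h _; rewrite mem_enum].
Qed.

End RowSums.

Lemma expR1_le (R : realType) : expR 1 <= 256 / 81 :> R.
Proof.
have h : 3 / 4 <= expR (- (1 / 4)) :> R by have := expR_ge1Dx (- (1 / 4) : R); lra.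
have e4 : expR 1 = (expR (1 / 4)) ^+ 4 :> R by rewrite -expRM_natl; congr expR; field.
have e1 : expR (1 / 4) * expR (- (1 / 4)) = 1 :> R by rewrite expRxMexpNx_1.
have le : expR (1 / 4) <= 4 / 3 :> R.
  have : expR (1 / 4) * (3 / 4) <= expR (1 / 4) * expR (- (1 / 4)) :> R.
    by rewrite ler_wpM2l // expR_ge0.
  by rewrite e1; lra.
have -> : 256 / 81 = (4 / 3) ^+ 4 :> R by field.
by rewrite e4 lerXn2r ?nnegrE ?expR_ge0 //; lra.
Qed.

Lemma compound_le_expR1 (R : realType) d : (0 < d)%N ->
  (1 + d%:R^-1) ^+ d <= expR 1 :> R.
Proof.
move=> d0; have dR : (d%:R : R) != 0 by rewrite pnatr_eq0 -lt0n.
have -> : expR 1 = expR (d%:R^-1) ^+ d :> R by rewrite -expRM_natl divff.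
by rewrite lerXn2r ?nnegrE ?expR_ge0 ?addr_ge0 ?invr_ge0 ?expR_ge1Dx.
Qed.

Lemma bernoulli_le (R : realType) (x : R) n : 0 <= x -> 1 + n%:R * x <= (1 + x) ^+ n.
Proof.
move=> x0; elim: n => [|n ih]; first by rewrite mul0r addr0 expr0.
rewrite exprS -natr1; have nx0 : 0 <= n%:R * x by rewrite mulr_ge0.
have : (1 + x) * (1 + n%:R * x) <= (1 + x) * (1 + x) ^+ n by rewrite ler_wpM2l // addr_ge0.
have : 0 <= x * (n%:R * x) by rewrite mulr_ge0.
lra.
Qed.

(** Polynomial growth of degree d leaves no room for a factor 4 at every scale.
    Were there one for each t, the scales t_{j+1} = t_j + ceil(t_j / d) would give
    B at least 4^j, while t_j = O((1 + 1/d)^j) bounds B by O(((1 + 1/d)^d)^j), and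
    (1 + 1/d)^d <= e <= 256/81. *)
Lemma growth_scale (R : realType) (d K : nat) (B : nat -> nat) : (0 < d)%N ->
  {homo B : i j / (i <= j)%N} -> (0 < B 0)%N ->
  (forall n, (B n <= (K * n + 1) ^ d)%N) ->
  exists2 t, (0 < t)%N & (B (t * d ^ 2 + t * d) <= 4 * B (t * d ^ 2))%N.
Proof.
move=> d0 Bmon B0 Bpoly; apply: contrapT => no.
have grow t : (0 < t)%N -> (4 * B (t * d ^ 2) < B (t * d ^ 2 + t * d))%N.
  by move=> t0; rewrite ltnNge; apply/negP => h; apply: no; exists t.
pose t j := iter j (fun t => (t + (t + d.-1) %/ d)%N) 1%N.
have tpos j : (0 < t j)%N by elim: j => // j ih; rewrite /t iterS -/(t j) addn_gt0 ih.
have tS j : (t j * d ^ 2 + t j * d <= t j.+1 * d ^ 2)%N.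
  rewrite [t j.+1]/t iterS -/(t j) mulnDl leq_add2l expnS expn1 mulnA leq_pmul2r //.
  have := divn_eq (t j + d.-1) d; have := ltn_pmod (t j + d.-1) d0.
  move: (_ %/ _)%N (_ %% _)%N => q r; lia.
have low j : (4 ^ j <= B (t j * d ^ 2))%N.
  elim: j => [|j ih].
    by rewrite expn0; apply: leq_trans B0 _; apply: Bmon.
  apply: leq_trans (Bmon _ _ (tS j)); apply: leq_trans (ltnW (grow _ (tpos j))).
  by rewrite expnS leq_mul2l ih orbT.
have dR : 0 < d%:R :> R by rewrite ltr0n.
pose r : R := 1 + d%:R^-1.
have r0 : 0 <= r by rewrite addr_ge0 // invr_ge0.
have dr : d%:R * r = d%:R + 1 by rewrite /r mulrDr mulr1 divff ?gt_eqF.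
(* The shift by d turns the additive error of the rounding into a clean
   geometric progression. *)
have tle j : (t j)%:R + d%:R <= (1 + d%:R) * r ^+ j.
  elim: j => [|j ih]; first by rewrite expr0 mulr1.
  have : (t j.+1)%:R <= (t j)%:R * r + 1 :> R.
    rewrite [t j.+1]/t iterS -/(t j) natrD mulrDr mulr1 -addrA lerD2l.
    have : ((t j + d.-1) %/ d * d)%:R <= (t j + d)%:R :> R.
      by rewrite ler_nat; apply: leq_trans (leq_divM _ _) _; rewrite leq_add2l leq_pred.
    by rewrite natrM natrD -ler_pdivlMr // mulrDl divff ?gt_eqF.
  have -> : (1 + d%:R) * r ^+ j.+1 = ((1 + d%:R) * r ^+ j) * r by rewrite exprSr mulrA.
  have : ((t j)%:R + d%:R) * r <= ((1 + d%:R) * r ^+ j) * r by rewrite ler_wpM2r.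
  rewrite mulrDl dr; move=> h1 h2.
  by apply: le_trans h1; rewrite [d%:R + 1]addrC addrA lerD2r.
pose Q : R := ((K%:R * d%:R ^+ 2 + 1) * (1 + d%:R)) ^+ d.
have Q0 : 0 <= Q by rewrite exprn_ge0 // mulr_ge0 // addr_ge0 // mulr_ge0 // exprn_ge0.
have up j : (4 ^+ j : R) <= Q * (256 / 81) ^+ j.
  have : (4 ^ j)%:R <= ((K * (t j * d ^ 2) + 1) ^ d)%:R :> R.
    by rewrite ler_nat; apply: leq_trans (low j) (Bpoly _).
  rewrite !natrX => h; apply: (le_trans h) => {h}.
  apply: (@le_trans _ _ (Q * (r ^+ d) ^+ j)); last first.
    rewrite ler_wpM2l //; apply: lerXn2r; rewrite ?nnegrE ?exprn_ge0 ?divr_ge0 ?ler0n //.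
    by apply: le_trans (compound_le_expR1 R d0) (expR1_le R).
  rewrite exprAC -exprMn lerXn2r ?nnegrE ?ler0n //.
    by rewrite !mulr_ge0 ?exprn_ge0 ?addr_ge0 ?mulr_ge0.
  rewrite -mulrA; apply: (@le_trans _ _ ((K%:R * d%:R ^+ 2 + 1) * (t j)%:R)).
    rewrite natrD natrM natrM natrX mulrDl mul1r lerD ?ler1n ?tpos //.
    by rewrite -mulrA [(t j)%:R * _]mulrC.
  rewrite ler_wpM2l ?addr_ge0 ?mulr_ge0 //; apply: le_trans (tle j).
  by rewrite lerDl.
have [N QN] : exists N : nat, Q < N%:R * (17 / 64).
  exists (Num.truncn (Q / (17 / 64))).+1.
  by rewrite -ltr_pdivrMr ?truncnS_gt //; lra.
have := up N; have e : 4 = (1 + 17 / 64) * (256 / 81) :> R by field.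
rewrite e exprMn ler_pM2r; last by rewrite exprn_gt0 //; lra.
rewrite leNgt => /negP; apply.
apply: lt_le_trans (bernoulli_le N _); last by lra.
by apply: (lt_trans QN); rewrite ltrDr.
Qed.

(** * Counting the normal cones met by a path of objectives *)

Lemma averaging_le {I : eqType} (X : seq I) (F : I -> nat) B :
  (0 < size X)%N -> (\sum_(x <- X) F x <= B * size X)%N ->
  exists2 x, x \in X & (F x <= B)%N.
Proof.
move=> X0 le; apply: contrapT => no.
have big x : x \in X -> (B < F x)%N.
  by move=> xX; rewrite ltnNge; apply/negP => h; apply: no; exists x.
suff: (B.+1 * size X <= \sum_(x <- X) F x)%N.
  by move=> h; have := leq_trans h le; rewrite leq_pmul2r // ltnn.
elim: X big {X0 le no} => [|x X ih] big; first by rewrite big_nil muln0.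
rewrite big_cons /= mulnS leq_add ?big ?mem_head //.
by apply: ih => y yX; apply: big; rewrite inE yX orbT.
Qed.

Section Pushing.
Context {R : realType} {m d : nat} (A : 'M[int]_(m, d)) (b : 'cV[int]_m).
Context {Delta : R} (minA : minors_bounded d (row_mx A b) Delta).
Implicit Types (q : 'rV[R]_d) (p w z : 'cV[R]_d) (x u : 'rV[int]_d).

Let AR : 'M[R]_(m, d) := Defs.realmx R A.
Let bR : 'cV[R]_m := Defs.realmx R b.
Let P := hpolyhedron AR bR.
Let a i : 'rV[R]_d := row i AR.
Let ray w := extreme_ray AR (tight AR bR w).
Hypothesis norec : forall u : 'cV[R]_d, u != 0 -> exists i, 0 < dot (a i) u.

Definition intvec x : 'rV[R]_d := map_mx intr x.

Lemma intvecD x y : intvec (x + y) = intvec x + intvec y.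
Proof. exact: map_mxD. Qed.

Lemma intvecMn x t : intvec (x *+ t) = t%:R *: intvec x.
Proof. by rewrite /intvec raddfMn scaler_nat. Qed.

Lemma intvec_row i : intvec (row i A) = row i AR.
Proof. by apply/matrixP => k j; rewrite !mxE. Qed.

Definition small_on_rows z := forall r, `|dot (a r) z| <= Delta.

(** Adding u moves an objective away from all walls of the normal cone of w, by
    at least 1 for the scaling of the edge directions bounded by the minors. *)
Definition pushes w u := forall z, ray w z ->
  exists2 mu, 0 < mu & small_on_rows (mu *: z) /\ dot (intvec u) (mu *: z) <= -1.

Lemma vertex_pushed w : vertices P w ->
  exists2 u, u \in row_sums A d & pushes w u.
Proof.
move=> /vertexP[_ pw]; have [f [fT detf]] := pinned_basis pw.
exists (\sum_k row (f k) A); first exact: sum_rows_mem.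
move=> z ez; have [mu mu0 [h1 h2]] := extreme_ray_push minA fT detf ez.
exists mu => //; split=> //; suff -> : intvec (\sum_k row (f k) A) = \sum_k row (f k) AR by [].
by rewrite /intvec raddf_sum; apply: eq_bigr => k _; exact: intvec_row.
Qed.

Lemma vertex_Delta_ge1 w : vertices P w -> 1 <= Delta.
Proof.
move=> /vertexP[_ pw]; have [f [_ detf]] := pinned_basis pw.
exact: (minor_bound_ge1 minA detf).
Qed.

Lemma row_sums_dot n x z : 0 <= Delta -> x \in row_sums A n -> small_on_rows z ->
  `|dot (intvec x) z| <= n%:R * Delta.
Proof.
move=> D0 + sz; elim: n x => [|n ih] x.
  by rewrite inE => /eqP ->; rewrite /intvec map_mx0 dot0l normr0 mul0r.
move=> /row_sumsS[y /ih yn h]; rewrite -natr1 mulrDl mul1r.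
have [->|[i ->]] := h; first by rewrite (le_trans yn) // lerDl.
rewrite intvecD dotDl; apply: le_trans (ler_normD _ _) _; apply: lerD => //.
by rewrite intvec_row; apply: sz.
Qed.

(** The hypothesis on q' says that q' violates each edge inequality at w by less
    than t, whatever the vertex w that is optimal for q. *)
Lemma pushed_unique q q' w u (t : nat) : vertices P w -> optimal AR bR q w -> pushes w u ->
  (forall z, small_on_rows z -> dot q z <= 0 -> dot q' z < t%:R) ->
  optimal AR bR (q' + intvec (u *+ t)) w /\
  forall p, optimal AR bR (q' + intvec (u *+ t)) p -> p = w.
Proof.
move=> Vw ow push close.
have neg z : ray w z -> dot (q' + intvec (u *+ t)) z < 0.
  move=> ez; have [mu mu0 [sz uz]] := push z ez.
  have qz : dot q (mu *: z) <= 0.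
    by rewrite dotZr pmulr_rle0 //; apply: (optimal_ray norec Vw ow ez).
  have := close _ sz qz => lt.
  rewrite -(pmulr_rlt0 _ mu0) -dotZr dotDl intvecMn dotZl.
  have : t%:R * dot (intvec u) (mu *: z) <= t%:R * -1 by rewrite ler_wpM2l.
  lra.
split; first by apply: rays_optimal => // z /neg /ltW.
by move=> p; apply: rays_unique_optimal.
Qed.

Section Counting.
Context {V : seq 'cV[R]_d} (uV : uniq V) (VP : forall w, w \in V <-> vertices P w).

(** The map sending a pair (x, w), with w hit by x, to x + t u_w is injective:
    w is recovered as the only vertex optimal at its value shifted by c0, and then
    x by subtraction. *)
Lemma count_hits (n t : nat) (c0 : 'rV[R]_d) (hit : 'rV[int]_d -> pred 'cV[R]_d) :
  (forall x w, x \in row_sums A n -> w \in V -> hit x w ->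
    exists2 q, optimal AR bR q w & forall z, small_on_rows z -> dot q z <= 0 ->
      dot (intvec x + c0) z < t%:R) ->
  (\sum_(x <- row_sums A n) count (hit x) V <= size (row_sums A (n + t * d)))%N.
Proof.
move=> hitP.
have /choice[u uP] : forall w, exists u, w \in V -> u \in row_sums A d /\ pushes w u.
  move=> w; have [wV|nV] := boolP (w \in V); last by exists 0.
  by have [u u1 u2] := vertex_pushed ((VP w).1 wV); exists u.
pose L := [seq (x, w) | x <- row_sums A n, w <- [seq w <- V | hit x w]].
pose g (pr : 'rV[int]_d * 'cV[R]_d) := pr.1 + u pr.2 *+ t.
have LP (pr : 'rV[int]_d * 'cV[R]_d) : pr \in L -> [/\ pr.1 \in row_sums A n, pr.2 \in V & hit pr.1 pr.2].
  by case/allpairsPdep => x [w [xn]]; rewrite mem_filter => /andP[h wV] ->.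
have uniqopt (pr : 'rV[int]_d * 'cV[R]_d) : pr \in L ->
    optimal AR bR (intvec (g pr) + c0) pr.2 /\
    forall w', optimal AR bR (intvec (g pr) + c0) w' -> w' = pr.2.
  move=> /LP[xn wV h]; have [q qo qz] := hitP _ _ xn wV h.
  have [_ pu] := uP _ wV.
  rewrite /g intvecD addrAC.
  by apply: (@pushed_unique q) => //; apply/VP.
have ginj : {in L &, injective g}.
  move=> pr pr' prL pr'L e.
  have [opt1 _] := uniqopt pr prL; have [_ uq2] := uniqopt pr' pr'L.
  have e2 : pr.2 = pr'.2 by apply: uq2; rewrite -e.
  have e1 : pr.1 = pr'.1 by move: e; rewrite /g e2 => /addIr.
  by rewrite [pr]surjective_pairing [pr']surjective_pairing e1 e2.
have uL : uniq L.
  apply: allpairs_uniq_dep; first exact: row_sums_uniq.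
    by move=> x _; apply: filter_uniq.
  by move=> [x w] [x' w'] _ _ /= [-> ->].
have -> : (\sum_(x <- row_sums A n) count (hit x) V)%N = size L.
  rewrite size_allpairs_dep sumnE big_map; apply: eq_bigr => x _.
  by rewrite size_filter.
rewrite -(size_map g); apply: uniq_leq_size; first by rewrite map_inj_in_uniq.
move=> y /mapP[pr /LP[xn wV _] ->]; apply: row_sumsD => //.
by apply: row_sums_muln; have [] := uP _ wV.
Qed.

Definition visited (q c : 'rV[R]_d) (s0 s1 : R) (w : 'cV[R]_d) :=
  `[< exists2 s, s0 <= s <= s1 & optimal AR bR (q + s *: c) w >].

(** For an edge direction z bounded on the rows, s c_v z is at most s1 d Delta in
    absolute value, so moving from s to 0 costs less than t. *)
Lemma count_first (n t : nat) v0 (s1 : R) : 0 <= Delta ->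
  v0 \in row_sums A d -> s1 * d%:R * Delta < t%:R ->
  (\sum_(x <- row_sums A n) count (visited (intvec x) (intvec v0) 0 s1) V
     <= size (row_sums A (n + t * d)))%N.
Proof.
move=> D0 v0d lt; apply: (@count_hits n t 0) => x w xn wV /asboolP[s /andP[s0 ss1] o].
exists (intvec x + s *: intvec v0) => // z sz; rewrite addr0 dotDl dotZl => le.
have := row_sums_dot D0 v0d sz; rewrite ler_norml => /andP[h _].
have : s * (- (d%:R * Delta)) <= s * dot (intvec v0) z by rewrite ler_wpM2l.
have : s * (d%:R * Delta) <= s1 * (d%:R * Delta) by rewrite ler_wpM2r // mulr_ge0.
lra.
Qed.

(** Dividing the objective x + s c by s / s0 keeps the cones and turns it into
    (s0 / s) x + s0 c, which is close to x + s0 c since x is a sum of n rows and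
    1 - s0 / s < eta.  This is why pieces of constant ratio suffice, and where the
    logarithm comes from. *)
Lemma count_scaled (n t : nat) v0 (s0 eta : R) : 0 <= Delta -> 0 < s0 -> 0 < eta ->
  v0 \in row_sums A d -> eta * n%:R * Delta <= t%:R -> (0 < t)%N ->
  (\sum_(x <- row_sums A n)
     count (visited (intvec x) (intvec v0) s0 (s0 * (1 + eta))) V
     <= size (row_sums A (n + t * d)))%N.
Proof.
move=> D0 s00 eta0 v0d lt t0.
apply: (@count_hits n t (s0 *: intvec v0)) => x w xn wV /asboolP[s /andP[s0s ss1] o].
exists (intvec x + s *: intvec v0) => // z sz; rewrite !dotDl !dotZl => le.
have := row_sums_dot D0 xn sz; rewrite ler_norml => /andP[_ h].
set X := dot (intvec x) z in le h *; set C := dot (intvec v0) z in le *.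
have s_gt0 : 0 < s by exact: lt_le_trans s00 s0s.
rewrite -(ltr_pM2l s_gt0).
have -> : s * (X + s0 * C) = s0 * (X + s * C) + (s - s0) * X by ring.
have t0R : 0 < t%:R :> R by rewrite ltr0n.
have h1 : s0 * (X + s * C) <= 0 by rewrite pmulr_rle0.
have h2 : (s - s0) * X <= (s - s0) * (n%:R * Delta) by rewrite ler_wpM2l // subr_ge0.
have nD0 : 0 <= n%:R * Delta by rewrite mulr_ge0.
have [e|ne] := eqVneq s s0.
  have st : 0 < s * t%:R by rewrite mulr_gt0.
  by rewrite [X in _ + X](_ : _ = 0) ?addr0 ?(le_lt_trans h1) // e subrr mul0r.
have lts : s0 < s by rewrite lt_neqAle eq_sym ne.
have h3 : (s - s0) * (n%:R * Delta) <= (s0 * eta) * (n%:R * Delta).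
  by rewrite ler_wpM2r //; lra.
have h4 : s0 * (eta * n%:R * Delta) <= s0 * t%:R by rewrite ler_wpM2l // ltW.
have h5 : s0 * t%:R < s * t%:R by rewrite ltr_pM2r.
lra.
Qed.

End Counting.

End Pushing.

Arguments small_on_rows {R m d} A Delta z.
Arguments pushes {R m d} A b Delta w u.

(** * Short walks *)

Lemma double_le_octuple (N B1 B2 : nat) : (B1 <= 4 * B2)%N ->
  (N * B1 + N * B1 <= 8 * N * B2)%N.
Proof. nia. Qed.

Section ShortWalk.
Context {R : realType} {m d : nat} (A : 'M[int]_(m, d)) (b : 'cV[int]_m).
Context {Delta : R} (minA : minors_bounded d (row_mx A b) Delta).
Implicit Types (q : 'rV[R]_d) (p w z : 'cV[R]_d) (x u : 'rV[int]_d).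

Let AR : 'M[R]_(m, d) := Defs.realmx R A.
Let bR : 'cV[R]_m := Defs.realmx R b.
Let P := hpolyhedron AR bR.
Let a i : 'rV[R]_d := row i AR.
Hypothesis norec : forall u : 'cV[R]_d, u != 0 -> exists i, 0 < dot (a i) u.
Hypothesis d0 : (0 < d)%N.

(** The first piece and k pieces of ratio 1 + eta cover the segment. *)
Lemma count_segment V (n t : nat) v0 (s0 eta : R) k :
  uniq V -> (forall w, w \in V <-> vertices P w) ->
  0 <= Delta -> 0 < s0 -> 0 < eta -> v0 \in row_sums A d -> (0 < t)%N ->
  s0 * d%:R * Delta < t%:R -> eta * n%:R * Delta <= t%:R ->
  (\sum_(x <- row_sums A n)
     count (visited A b (intvec x) (intvec v0) 0 (s0 * (1 + eta) ^+ k)) V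
     <= k.+1 * size (row_sums A (n + t * d)))%N.
Proof.
move=> uV VP D0 s00 eta0 v0d t0 lt1 lt2; elim: k => [|k ih].
  by rewrite expr0 mulr1 mul1n; apply: (count_first minA norec uV VP).
have sk0 : 0 < s0 * (1 + eta) ^+ k by rewrite mulr_gt0 // exprn_gt0 //; lra.
have := count_scaled minA norec uV VP D0 sk0 eta0 v0d lt2 t0.
move=> /(leq_add ih); rewrite -mulSnr; apply: leq_trans.
rewrite -big_split /=; apply: leq_sum => x _; rewrite -count_predUI.
apply: leq_trans (leq_addr _ _); apply: sub_count => w /asboolP[s /andP[s0' s1] o].
have [le|le] := leP s (s0 * (1 + eta) ^+ k).
  by apply/orP; left; apply/asboolP; exists s; rewrite ?s0' ?le.
apply/orP; right; apply/asboolP; exists s => //.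
by rewrite (ltW le) -mulrA -exprSr s1.
Qed.

Lemma push_target_optimal n x v0 v (S : R) : 0 <= Delta ->
  vertices P v -> pushes A b Delta v v0 -> x \in row_sums A n -> n%:R * Delta <= S ->
  optimal AR bR (intvec x + S *: intvec v0) v.
Proof.
move=> D0 Vv push xn le; apply: rays_optimal => // z ez.
have [mu mu0 [sz vz]] := push z ez.
rewrite -(pmulr_rle0 _ mu0) -dotZr dotDl dotZl.
have := row_sums_dot D0 xn sz; rewrite ler_norml => /andP[_ h].
have S0 : 0 <= S by apply: le_trans le; rewrite mulr_ge0.
have : S * dot (intvec v0) (mu *: z) <= S * -1 by rewrite ler_wpM2l.
lra.
Qed.

(** Both legs of the path contain the objective x itself, so the vertices visited
    on the two legs together still form a connected set. *)
Lemma short_walk N (u v : matrix R d 1) : vertices P u -> vertices P v ->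
  2 * d%:R ^+ 3 * Delta ^+ 2 <= (1 + (d%:R ^+ 2 * Delta)^-1) ^+ N ->
  exists2 k, (k <= 8 * N.+1)%N & walk (vertex_adj P) k u v.
Proof.
move=> Vu Vv leN.
have D1 := vertex_Delta_ge1 minA Vu.
have D0 : 0 <= Delta by lra.
have dR : 1 <= d%:R :> R by rewrite ler1n.
have [V [uV VP]] := finite_vertices AR bR.
have [u0 u0d upush] := vertex_pushed minA Vu.
have [v0 v0d vpush] := vertex_pushed minA Vv.
pose M := (\max_i \max_j `|A i j|)%N.
have AM i j : (`|A i j| <= M)%N.
  by apply: leq_trans (leq_bigmax i); exact: (leq_bigmax j).
have [|||t t0 tle] := @growth_scale R d (2 * M) (fun n => size (row_sums A n)) d0.
- by move=> i j; apply: size_row_sums_le.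
- exact: size_row_sums_gt0.
- by move=> n; rewrite -mulnA [(M * n)%N]mulnC; apply: size_row_sums.
set n := (t * d ^ 2)%N in tle.
have tR : 0 < t%:R :> R by rewrite ltr0n.
pose eta : R := (d%:R ^+ 2 * Delta)^-1.
have dD0 : 0 < d%:R ^+ 2 * Delta by rewrite mulr_gt0 ?exprn_gt0 //; lra.
have eta0 : 0 < eta by rewrite invr_gt0.
pose s0 : R := t%:R / (2 * d%:R * Delta).
have dD20 : 0 < 2 * d%:R * Delta by rewrite !mulr_gt0 //; lra.
have s00 : 0 < s0 by rewrite divr_gt0.
have lt1 : s0 * d%:R * Delta < t%:R.
  have -> : s0 * d%:R * Delta = t%:R / 2 by rewrite /s0; field; lra.
  lra.
have lt2 : eta * n%:R * Delta <= t%:R.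
  suff -> : eta * n%:R * Delta = t%:R by [].
  by rewrite /eta /n natrM natrX; field; lra.
pose S := s0 * (1 + eta) ^+ N.
have S0 : 0 <= S by rewrite mulr_ge0 ?exprn_ge0 //; lra.
have nS : n%:R * Delta <= S.
  have -> : n%:R * Delta = s0 * (2 * d%:R ^+ 3 * Delta ^+ 2).
    by rewrite /n /s0 natrM natrX; field; lra.
  by rewrite ler_wpM2l // ltW.
pose vis u1 x w := visited A b (intvec x) (intvec u1) 0 S w.
have [x xn xle] : exists2 x, x \in row_sums A n &
    (count (vis u0 x) V + count (vis v0 x) V <= 8 * N.+1)%N.
  apply: averaging_le; first exact: size_row_sums_gt0.
  rewrite big_split /=.
  have h1 := count_segment N uV VP D0 s00 eta0 u0d t0 lt1 lt2.
  have h2 := count_segment N uV VP D0 s00 eta0 v0d t0 lt1 lt2.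
  apply: leq_trans (leq_add h1 h2) _.
  exact: double_le_octuple.
pose U := [seq w <- V | vis u0 x w || vis v0 x w].
have sU : (size U <= 8 * N.+1)%N.
  apply: leq_trans xle; rewrite size_filter -count_predUI.
  by apply: leq_addr.
have SS : (0 : R) <= S <= S by apply/andP.
have SS0 : (0 : R) <= 0 <= S by apply/andP.
have end_ w u1 : vertices P w -> pushes A b Delta w u1 -> vis u1 x w.
  move=> Vw pw; apply/asboolP; exists S => //; exact: push_target_optimal pw xn nS.
have uU : u \in U by rewrite mem_filter (end_ u u0) //; apply/VP.
have vU : v \in U by rewrite mem_filter (end_ v v0) ?orbT //; apply/VP.
have [p Vp po] := optimal_vertex_exists norec (intvec x) (ex_intro _ u Vu).
have po' u1 : optimal AR bR (intvec x + 0 *: intvec u1) p by rewrite scale0r addr0.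
have [|k kU wk] := connected_walk (adj := vertex_adj P) (U := U) (filter_uniq _ uV) uU _ vU.
  move=> L [x1 x1U Lx1] [y1 y1U Ly1].
  have inU u1 : u1 = u0 \/ u1 = v0 -> forall w, vertices P w -> vis u1 x w -> w \in U.
    by move=> h w /VP wV vw; rewrite mem_filter wV andbT; case: h => <-; rewrite vw ?orbT.
  (* The vertex p is optimal at x, hence visited on both legs; one of the two
     sides of the cut therefore has a vertex on the same leg as p. *)
  have seg u1 w1 w2 : u1 = u0 \/ u1 = v0 -> vertices P w1 -> vis u1 x w1 -> L w1 ->
      vertices P w2 -> vis u1 x w2 -> ~~ L w2 ->
      exists y z, [/\ y \in U, z \in U, L y, ~~ L z & vertex_adj P y z].
    move=> hu1 V1 /asboolP[s1 h1 opt1] L1 V2 /asboolP[s2 h2 opt2] L2.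
    have [s [y [z [hs [Vy oy] [Vz oz] [Ly [Lz adj]]]]]] :=
      optimal_segment_cut norec h1 V1 opt1 L1 h2 V2 opt2 L2.
    by exists y, z; split=> //; apply: (inU u1) => //; apply/asboolP; exists s.
  have visp u1 : vis u1 x p by apply/asboolP; exists 0.
  have visU y : y \in U -> vertices P y /\ exists2 u1, u1 = u0 \/ u1 = v0 & vis u1 x y.
    rewrite mem_filter => /andP[/orP[h|h] /VP Vy]; split=> //.
      by exists u0 => //; left.
    by exists v0 => //; right.
  have [Lp|Lp] := boolP (L p).
    have [Vy [u1 hu1 vy]] := visU _ y1U.
    exact: (seg u1 p y1).
  have [Vx [u1 hu1 vx]] := visU _ x1U.
  exact: (seg u1 x1 p).
by exists k => //; apply: ltnW; apply: leq_trans kU sU.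
Qed.

End ShortWalk.

(** * Size of the data and the final estimate *)

Section Boundedness.
Context {R : realType} {m d : nat} (A : 'M[R]_(m, d)) (b : 'cV[R]_m).

Lemma bounded_no_recession (u : 'cV[R]_d) :
  bounded_set (hpolyhedron A b) -> hpolyhedron A b 0 -> u != 0 ->
  exists i, 0 < dot (row i A) u.
Proof.
move=> [M0 [_ /(_ (M0 + 1))]]; rewrite ltrDl => /(_ ltr01).
set M := M0 + 1 => Mle P0 u0; apply: contrapT => no.
have un0 : 0 < `|u| by rewrite normr_gt0.
pose t := (`|M| + 1) / `|u|.
have t0 : 0 <= t by rewrite divr_ge0 // addr_ge0.
have : hpolyhedron A b (t *: u).
  apply/hpolyhedronP => i; rewrite dotZr.
  have /hpolyhedronP/(_ i) := P0; rewrite dot0r; apply: le_trans.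
  rewrite mulr_ge0_le0 // leNgt; apply/negP => h; apply: no; by exists i.
move=> /Mle /=; rewrite normrZ (ger0_norm t0) divfK ?gt_eqF //.
by have := ler_norm M; lra.
Qed.

(** A small multiple of the row itself is a point of the polyhedron. *)
Lemma interior_row_pos i : interior (hpolyhedron A b) 0 -> row i A != 0 -> 0 < b i 0.
Proof.
move=> /nbhs_ballP[e /= e0 be] ai0.
pose v := (row i A)^T; have v0 : v != 0 by rewrite trmx_eq0.
have vn0 : 0 < `|v| by rewrite normr_gt0.
have t0 : 0 < e / 2 / `|v| by rewrite !divr_gt0.
have /hpolyhedronP/(_ i) : hpolyhedron A b ((e / 2 / `|v|) *: v).
  apply: be; rewrite -ball_normE /= sub0r normrN normrZ gtr0_norm // divfK ?gt_eqF //.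
  lra.
apply: lt_le_trans; rewrite dotZr pmulr_rgt0 // /dot mxE.
have [j aj] : exists j, row i A 0 j != 0.
  apply: contrapT => no; move/eqP: ai0; apply; apply/matrixP => k j.
  by rewrite (ord1 k) [RHS]mxE; apply/eqP/negPn/negP => h; apply: no; exists j.
rewrite (bigD1 j) //= ltr_pwDl //.
  by rewrite [v _ _]mxE -expr2 exprn_even_gt0 //=.
by apply: sumr_ge0 => k _; rewrite [v _ _]mxE -expr2 sqr_ge0.
Qed.

End Boundedness.

Lemma entry_le_maxnorm (R : realType) m n (M : 'M[int]_(m, n)) i j :
  `|M i j|%:~R <= maxnorm R M.
Proof.
rewrite /maxnorm -[leRHS]/(mx_norm (Defs.realmx R M)) mx_normrE.
have -> : `|M i j|%:~R = `|Defs.realmx R M i j| :> R by rewrite mxE intr_norm.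
by apply: (le_bigmax _ (fun ij => `|Defs.realmx R M ij.1 ij.2|) (i, j)).
Qed.

Lemma entry_maxnorm_ge1 (R : realType) m n (M : 'M[int]_(m, n)) i j :
  M i j != 0 -> 1 <= maxnorm R M.
Proof.
move=> Mij; apply: le_trans (entry_le_maxnorm R M i j).
by rewrite (ler_int R 1); move: Mij; lia.
Qed.

(** Since exp(1 / (2 D)) <= 1 + 1 / D for D = d^2 Delta >= 1, taking N at least
    8 D log(m Delta) gives (1 + 1 / D)^N >= (m Delta)^4, and 2 d^3 <= m^4. *)
Lemma step_count (R : realType) (d m : nat) (Delta : R) :
  (0 < d)%N -> (d <= m)%N -> (1 < m)%N -> 1 <= Delta ->
  exists2 N : nat, 2 * d%:R ^+ 3 * Delta ^+ 2 <= (1 + (d%:R ^+ 2 * Delta)^-1) ^+ N &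
    (8 * N.+1)%:R <= 96 * (d%:R ^+ 2 * Delta) * ln (m%:R * Delta).
Proof.
move=> d0 dm m1 D1.
have dR : 1 <= d%:R :> R by rewrite ler1n.
have dmR : d%:R <= m%:R :> R by rewrite ler_nat.
have mR : 2 <= m%:R :> R by rewrite ler_nat.
set D := d%:R ^+ 2 * Delta; set L := ln (m%:R * Delta).
have D_ge1 : 1 <= D by rewrite /D mulr_ege1 // exprn_ege1.
have mD2 : 2 <= m%:R * Delta by rewrite -[2]mulr1 ler_pM.
have mD0 : 0 < m%:R * Delta by lra.
have eL : expR L = m%:R * Delta by apply: lnK; rewrite posrE.
have half : 1 / 2 <= L.
  rewrite -ler_expR eL; apply: le_trans mD2.
  have := expR_ge1Dx (- (1 / 2) : R); have := expRxMexpNx_1 (1 / 2 : R).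
  have := expR_gt0 (1 / 2 : R); set u := expR (1 / 2); set w := expR _ => u0 uw w2.
  have : u * (1 / 2) <= u * w by rewrite ler_wpM2l ?(ltW u0) //; lra.
  lra.
have base : expR (1 / (2 * D)) <= 1 + D^-1.
  have := expR_ge1Dx (- (1 / (2 * D))); have := expRxMexpNx_1 (1 / (2 * D)).
  have := expR_gt0 (1 / (2 * D)); set u := expR (1 / (2 * D)); set w := expR _ => u0 uw w2.
  have h : u * (1 + - (1 / (2 * D))) <= 1 by rewrite -[leRHS]uw ler_wpM2l // ltW.
  have c0 : 0 < 1 + - (1 / (2 * D)).
    by rewrite subr_gt0 ltr_pdivrMr ?mul1r; lra.
  rewrite -(ler_pM2r c0); apply: (le_trans h).
  have -> : (1 + D^-1) * (1 + - (1 / (2 * D))) = 1 + (D - 1) / (2 * D ^+ 2) by field; lra.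
  have D2 : 0 <= 2 * D ^+ 2 by rewrite mulr_ge0 // exprn_ge0 //; lra.
  by rewrite lerDl divr_ge0 // subr_ge0.
have DL0 : 0 <= 8 * D * L by rewrite !mulr_ge0 //; lra.
exists (Num.truncn (8 * D * L)).+1.
  set N := (Num.truncn _).+1.
  have lN : 8 * D * L <= N%:R by rewrite ltW // truncnS_gt.
  apply: (@le_trans _ _ (expR (1 / (2 * D)) ^+ N)); last first.
    by rewrite lerXn2r ?nnegrE ?expR_ge0 // addr_ge0 // invr_ge0; lra.
  apply: (@le_trans _ _ (expR (4 * L))); last first.
    rewrite -expRM_natl ler_expR mulrA mulr1 ler_pdivlMr; last by lra.
    by apply: le_trans lN; rewrite le_eqVlt; apply/orP; left; apply/eqP; ring.
  rewrite expRM_natl eL exprMn; apply: ler_pM.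
  - by rewrite mulr_ge0 // exprn_ge0.
  - by rewrite exprn_ge0; lra.
  - rewrite [m%:R ^+ 4]exprS; apply: ler_pM; rewrite ?exprn_ge0 //.
    by apply: lerXn2r; rewrite ?nnegrE //; lra.
  - by rewrite ler_weXn2l.
set T := Num.truncn _; rewrite natrM -[T.+2]addn2 natrD.
have : T%:R <= 8 * D * L by rewrite truncn_le.
have : 1 / 2 <= D * L by rewrite -[1 / 2]mul1r ler_pM //; lra.
lra.
Qed.

Lemma graph_diameter_le (R : realType) (T : Type) (V : set T) adj (B : R) :
  (forall u v, V u -> V v -> exists2 k, k%:R <= B & walk adj k u v) ->
  (graph_diameter V adj <= B%:E)%E.
Proof.
move=> h; apply: ge_ereal_sup => _ [u Vu [v Vv <-]].
have [k kB wk] := h u v Vu Vv.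
apply: (@le_trans _ _ (k%:R)%:E); last by rewrite lee_fin.
by apply: ereal_inf_lbound; exists k.
Qed.

Theorem theorem1p1 (R : realType) :
  exists C : R, 0 < C /\
    forall (m d : nat) (A : 'M[int]_(m, d)) (b : 'cV[int]_m) (Delta : R),
      bounded_set (polyhedron R A b) ->
      interior (polyhedron R A b) 0 ->
      minors_bounded d (row_mx A b) Delta ->
      (vertex_diameter (polyhedron R A b) <=
        (C * d%:R ^+ 2 * Delta * maxnorm R A *
          ln (m%:R * maxnorm R A * maxnorm R b * Delta))%:E)%E.
Proof.
exists 96; split=> [//|m d A b Delta bnd int0 minA].
apply: graph_diameter_le => u v Vu Vv.
have [d0|d_gt0] := posnP d.
  exists 0%N; last by exists (fun=> u); split=> //; apply/matrixP => i; exfalso; move: i; rewrite d0 => -[].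
  have -> : d%:R = 0 :> R by rewrite d0.
  by rewrite expr0n /= !(mulr0, mul0r).
pose AR := Defs.realmx R A; pose bR := Defs.realmx R b.
have P0 : hpolyhedron AR bR 0 by exact: (interior_subset int0).
have norec (w : 'cV[R]_d) : w != 0 -> exists i, 0 < dot (row i AR) w.
  exact: (bounded_no_recession bnd P0).
have D1 : 1 <= Delta := vertex_Delta_ge1 minA Vu.
pose e : 'cV[R]_d := const_mx 1.
have e0 : e != 0.
  by apply/eqP => /matrixP/(_ (Ordinal d_gt0) 0)/eqP; rewrite !mxE oner_eq0.
(* No direction is a recession direction: applied to e and to - e this gives two
   different rows, and a nonzero entry of A. *)
have [i ai] := norec e e0.
have [j aj] : exists i, 0 < dot (row i AR) (- e) by apply: norec; rewrite oppr_eq0.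
have m1 : (1 < m)%N.
  have : i != j.
    apply: contraTneq aj => <-; rewrite -scaleN1r dotZr mulN1r oppr_gt0.
    by rewrite -leNgt ltW.
  by case: i {ai} => i im; case: j {aj} => j jm; rewrite -(inj_eq val_inj) /=; lia.
have dm : (d <= m)%N.
  have [_ pu] := (vertexP AR bR u).1 Vu; have [f [_ detf]] := pinned_basis pu.
  suff finj : injective f by have := leq_card f finj; rewrite !card_ord.
  move=> k l fkl; apply: contraNeq detf => kl; apply/eqP.
  by apply: (determinant_alternate kl) => c; rewrite !mxE fkl.
have rowi : row i AR != 0 by apply: contraTneq ai => ->; rewrite dot0l ltxx.
have A1 : 1 <= maxnorm R A.
  have [k aik] : exists k, A i k != 0.
    apply: contrapT => no; move/eqP: rowi; apply; apply/matrixP => l k.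
    rewrite !mxE; case: (eqVneq (A i k) 0) => [->//|h].
    by case: no; exists k.
  exact: entry_maxnorm_ge1 aik.
have b1 : 1 <= maxnorm R b.
  have := interior_row_pos int0 rowi; rewrite mxE ltr0z => bi.
  by apply: (@entry_maxnorm_ge1 _ _ _ b i 0); rewrite gt_eqF.
have [N hN NB] := step_count d_gt0 dm m1 D1.
have [k kN wk] := short_walk minA norec d_gt0 Vu Vv hN.
exists k => //.
have mR : 2 <= m%:R :> R by rewrite ler_nat.
have mD1 : 1 <= m%:R * Delta by rewrite mulr_ege1 //; lra.
apply: (@le_trans _ _ (8 * N.+1)%:R); first by rewrite ler_nat.
apply: (le_trans NB).
have D20 : 0 <= d%:R ^+ 2 * Delta by rewrite mulr_ge0 ?exprn_ge0 //; lra.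
have -> : 96 * d%:R ^+ 2 * Delta * maxnorm R A = 96 * (d%:R ^+ 2 * Delta) * maxnorm R A.
  by rewrite !mulrA.
have D960 : 0 <= 96 * (d%:R ^+ 2 * Delta) by rewrite mulr_ge0.
apply: ler_pM => //; [exact: ln_ge0|by rewrite ler_peMr|].
have AB1 : 1 <= maxnorm R A * maxnorm R b by rewrite mulr_ege1.
have -> : m%:R * maxnorm R A * maxnorm R b * Delta =
  (m%:R * Delta) * (maxnorm R A * maxnorm R b) by ring.
rewrite ler_ln ?posrE; first by rewrite ler_peMr //; lra.
  lra.
by rewrite mulr_gt0; lra.
Qed.
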